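(* For any finite set $X$, the poset $\operatorname{Bip}(X)$ of bipartitional relations on $X$, ordered by inclusion, is a lattice.
   Context: A relation $U\subseteq X\times X$ on a finite set $X$ is called bipartitional if both $U$ and its complement $(X\times X)\setminus U$ are transitive. $\operatorname{Bip}(X)$ denotes the set of all bipartitional relations on $X$, partially ordered by $U\le V$ if and only if $U\subseteq V$ as subsets of $X\times X$. *)

(* Defs.v *)
From HB Require Import structures.
From mathcomp Require Import all_boot all_order.

Set Implicit Arguments.
Unset Strict Implicit.
Unset Printing Implicit Defensive.

Import Order.Theory.

Local Open Scope order_scope.

Definition is_lattice (d : Order.disp_t) (P : porderType d) : Prop :=
  exists L : latticeType d, (L : porderType d) = P.

Lemma is_latticeP (d : Order.disp_t) (P : porderType d) :
  is_lattice P <->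
  exists meet join : P -> P -> P,
    (forall x y z : P, (x <= meet y z) = (x <= y) && (x <= z)) /\
    (forall x y z : P, (join x y <= z) = (x <= z) && (y <= z)).
Proof.
split=> [[L <-]|].
  exists Order.meet, Order.join; split=> x y z; first exact: lexI.
  exact: leUx.
case: P => T [? ? ? porderT] [meet [join [meetP joinP]]].
pose M := Order.POrder_isMeetSemilattice.Axioms_ porderT meet meetP.
pose J := Order.POrder_isJoinSemilattice.Axioms_ porderT join joinP.
by exists (Order.Lattice.Pack (Order.Lattice.Class M J)).
Qed.

Definition transitiveb (X : finType) (U : {set X * X}) : bool :=
  [forall x, forall y, forall z,
     ((x, y) \in U) && ((y, z) \in U) ==> ((x, z) \in U)].

Lemma transitivebP (X : finType) (U : {set X * X}) :
  reflect (transitive (fun x y => (x, y) \in U)) (transitiveb U).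
Proof.
apply: (iffP forallP) => [trU y x z Uxy Uyz | trU x].
  by have /forallP/(_ y)/forallP/(_ z) := trU x; rewrite Uxy Uyz.
apply/forallP => y; apply/forallP => z; apply/implyP => /andP[].
exact: trU.
Qed.

Definition bipartitional (X : finType) (U : {set X * X}) : bool :=
  transitiveb U && transitiveb (~: U).

Record bip (X : finType) : Type := Bip {
  bip_rel :> {set X * X};
  _ : bipartitional bip_rel
}.

HB.instance Definition _ (X : finType) := [isSub for @bip_rel X].
HB.instance Definition _ (X : finType) := [Finite of bip X by <:].

Definition le_bip (X : finType) (U V : bip X) : bool := bip_rel U \subset V.

Lemma le_bip_refl (X : finType) : reflexive (@le_bip X).
Proof. by move=> U; apply: subxx. Qed.

Lemma le_bip_anti (X : finType) : antisymmetric (@le_bip X).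
Proof. by move=> U V leUVU; apply/val_inj/eqP; rewrite eqEsubset. Qed.

Lemma le_bip_trans (X : finType) : transitive (@le_bip X).
Proof. by move=> V U W; apply: subset_trans. Qed.

HB.instance Definition _ (X : finType) :=
  Order.Le_isPOrder.Build Order.SetSubsetOrder.subset_display (bip X)
    (@le_bip_refl X) (@le_bip_anti X) (@le_bip_trans X).

Lemma leEbip (X : finType) (U V : bip X) :
  (U <= V) = (bip_rel U \subset bip_rel V).
Proof. by []. Qed.

(* Main.v *)
Require Import Defs.
From mathcomp Require Import all_boot all_order.

(** The join of two bipartitional relations [U] and [V] is the transitive
closure [T] of their union. Its complement is transitive: if [x = x0, x1, ...,
z] is a chain witnessing [(x, z) \in T] and [y] is arbitrary, its first step
lies in, say, [U], and co-transitivity of [U] gives [(x, y) \in U], whence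
[(x, y) \in T], or [(y, x1) \in U], whence [(y, z) \in T]. Complementation is
an order-reversing involution, so meets exist as well. *)

Set Implicit Arguments.
Unset Strict Implicit.
Unset Printing Implicit Defensive.

Local Open Scope order_scope.

Section TransitiveClosure.
Variable X : finType.
Implicit Types R S W : {set X * X}.

(** [connect] is reflexive, so a first step in [R] is required explicitly; otherwise the whole
    diagonal would be added. *)
Definition tclosure R : {set X * X} :=
  [set p | [exists w, ((p.1, w) \in R) && connect (fun a b => (a, b) \in R) w p.2]].

Lemma tclosureP R x z :
  reflect (exists2 w, (x, w) \in R & connect (fun a b => (a, b) \in R) w z)
          ((x, z) \in tclosure R).
Proof.
rewrite inE /=; apply: (iffP existsP) => [[w /andP[]]|[w Rxw Rwz]]; exists w => //.
by rewrite Rxw.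
Qed.

Lemma sub_tclosure R : R \subset tclosure R.
Proof. by apply/subsetP=> -[x z] Rxz; apply/tclosureP; exists z. Qed.

Lemma tclosure_trans R : transitiveb (tclosure R).
Proof.
apply/transitivebP=> y x z /tclosureP[w Rxw Rwy] /tclosureP[v Ryv Rvz].
apply/tclosureP; exists w => //; apply: connect_trans Rwy _.
exact: connect_trans (connect1 Ryv) Rvz.
Qed.

Lemma tclosure_subset R W :
  transitiveb W -> (tclosure R \subset W) = (R \subset W).
Proof.
move=> /transitivebP trW; apply/idP/idP; first exact/subset_trans/sub_tclosure.
move=> /subsetP sRW; apply/subsetP=> -[x z] /tclosureP[w /sRW Wxw /connectP[p]].
(* Induction along the path, with the invariant that [W] relates [x] to the current vertex [w]. *)
elim: p w Wxw => [|v p IHp] w Wxw /= => [_ -> //|/andP[Rwv Rp]].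
by apply: IHp Rp; apply: trW Wxw (sRW _ Rwv).
Qed.

Lemma transitiveb_setI R S :
  transitiveb R -> transitiveb S -> transitiveb (R :&: S).
Proof.
move=> /transitivebP trR /transitivebP trS; apply/transitivebP=> y x z.
rewrite !inE => /andP[Rxy Sxy] /andP[Ryz Syz].
by apply/andP; split; [exact: trR Rxy Ryz | exact: trS Sxy Syz].
Qed.

Lemma tclosure_bipartitional R :
  transitiveb (~: R) -> bipartitional (tclosure R).
Proof.
move=> /transitivebP cotrR; rewrite /bipartitional tclosure_trans /=.
apply/transitivebP=> y x z; rewrite !in_setC => nTxy nTyz.
apply/negP=> /tclosureP[w Rxw Rwz].
have nRxy: (x, y) \in ~: R.
  by rewrite in_setC; apply: contra nTxy; apply/subsetP/sub_tclosure.
(* Otherwise [y] could replace [x] at the start of the chain through [w] to [z]. *)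
have nRyw: (y, w) \in ~: R.
  by rewrite in_setC; apply: contra nTyz => Ryw; apply/tclosureP; exists w.
by have := cotrR _ _ _ nRxy nRyw; rewrite in_setC Rxw.
Qed.

End TransitiveClosure.

Section BipLattice.
Variable X : finType.
Implicit Types U V W : bip X.

Lemma bip_trans U : transitiveb U.
Proof. by case: U => R /= /andP[]. Qed.

Lemma bip_cotrans U : transitiveb (~: U).
Proof. by case: U => R /= /andP[]. Qed.

Fact bip_join_subproof U V : bipartitional (tclosure (U :|: V)).
Proof.
(* The complement of the union is an intersection of two transitive relations. *)
by apply: tclosure_bipartitional; rewrite setCU transitiveb_setI ?bip_cotrans.
Qed.

Definition bip_join U V : bip X := Bip (bip_join_subproof U V).

Fact bip_compl_subproof U : bipartitional (~: U).
Proof. by rewrite /bipartitional setCK bip_cotrans bip_trans. Qed.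

Definition bip_compl U : bip X := Bip (bip_compl_subproof U).

Lemma bip_joinP U V W : (bip_join U V <= W) = (U <= W) && (V <= W).
Proof. by rewrite !leEbip /= tclosure_subset ?bip_trans // subUset. Qed.

Lemma le_bip_compl U V : (U <= bip_compl V) = (V <= bip_compl U).
Proof. by rewrite !leEbip /= -setCS setCK. Qed.

Lemma bip_complK : involutive bip_compl.
Proof. by move=> U; apply/val_inj/setCK. Qed.

End BipLattice.

Theorem theorem4p1 (X : finType) : is_lattice (bip X).
Proof.
apply/is_latticeP.
(* The meet is the De Morgan dual of the join; plain intersection may fail to have a transitive
   complement. *)
exists (fun U V => bip_compl (bip_join (bip_compl U) (bip_compl V))), (@bip_join X).
split=> [U V W|]; last exact: bip_joinP.
(* The complement moves onto [U], the join splits, and each half is moved back. *)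
by rewrite le_bip_compl bip_joinP !(le_bip_compl _ U) !bip_complK.
Qed.
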